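(* Let $N\ge1$, $L,R>0$, $\gamma\ge0$. For any optimization algorithm satisfying the cone condition there exist a problem instance (a finite-dimensional Euclidean space $X$, an initial point $x_0\in X$, a function $f\in\mathcal F$, subgradients $g_k\in\partial f(x_k)$ and errors $e_0,\dots,e_{N-1}\in X$ with $\sum_{i=0}^{N-1}\|e_i\|^2\le\gamma^2$) for which the algorithm's output $x_{N+1}$ satisfies $f(x_{N+1})-f_\star\ge\Delta^\star$, where $\Delta^\star$ is the optimal value of $$\begin{array}{rl}\max\limits_{G\succeq0,\ \Delta\ge0}&\Delta\\ \text{s.t.}&G(g_j,g_i)+G(e_j,g_i)=0\quad\forall (i,j)\in\{0,\dots,N+1\}\times\{0,\dots,N-1\}:\ j<i,\\&G(g_j,g_i)+G(e_j,g_i)\ge0\quad\forall (i,j)\in\{0,\dots,N+1\}\times\{0,\dots,N-1\}:\ j\ge i,\\&G(x_0-x_\star,g_i)=\Delta\quad\forall i\in\{0,\dots,N+1\},\\&G(x_0-x_\star,x_0-x_\star)\le R^2,\\&G(g_i,g_i)\le L^2\quad\forall i\in\{0,\dots,N+1\},\\&\sum_{i=0}^{N-1}G(e_i,e_i)\le\gamma^2.\end{array}$$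
   Context: Given $X$ and $x_0\in X$, $\mathcal F$ is the class of convex $f:X\to\mathbb R$ all of whose subgradients (at all points) have norm at most $L$ and which attain their minimum $f_\star=f(x_\star)$ at some $x_\star$ with $\|x_\star-x_0\|\le R$. An optimization algorithm starts from $x_0$ and at each step $k=0,\dots,N-1$ receives a corrupted subgradient $\tilde g_k=g_k+e_k$ with $g_k\in\partial f(x_k)$ and $e_k$ chosen by an adversary; from the information received so far it chooses the next iterate, and after receiving $\tilde g_0,\dots,\tilde g_{N-1}$ it chooses $x_N$ and the output $x_{N+1}$. It satisfies the cone condition if always $$x_k\in x_0-\mathrm{cone}(\tilde g_0,\dots,\tilde g_{k-1})\ \ (k=1,\dots,N),\qquad x_{N+1}\in x_0-\mathrm{cone}(\tilde g_0,\dots,\tilde g_{N-1}),$$ where $\mathrm{cone}$ denotes the set of nonnegative linear combinations. The dimension of $X$ is not fixed in advance: the algorithm is defined for every finite-dimensional Euclidean space. In the program, $G$ is a real symmetric positive semidefinite matrix of size $(2N+3)\times(2N+3)$ whose rows and columns are indexed by the formal symbols $x_0-x_\star$, $g_0,\dots,g_{N+1}$, $e_0,\dots,e_{N-1}$, and $G(a,b)$ is the entry at row $a$, column $b$. *)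

(* Defs.v *)
From mathcomp Require Export all_boot all_order all_algebra.
From mathcomp Require Export classical_sets reals ereal convex.

Set Implicit Arguments.
Unset Strict Implicit.
Unset Printing Implicit Defensive.

Import Order.TTheory GRing.Theory Num.Theory.

Local Open Scope classical_set_scope.
Local Open Scope ring_scope.

(* The Euclidean space of dimension d is 'rV[R]_d with the standard inner
   product.  The library norm `|u| on 'rV[R]_d is the sup norm, hence enorm. *)
Definition dot (R : realType) (d : nat) (u v : 'rV[R]_d) : R :=
  (u *m v^T) 0 0.

Definition enorm (R : realType) (d : nat) (u : 'rV[R]_d) : R :=
  Num.sqrt (dot u u).

Definition subdifferential (R : realType) (d : nat) (f : 'rV[R]_d -> R)
    (x : 'rV[R]_d) : set 'rV[R]_d :=
  [set g | forall y, f x + dot g (y - x) <= f y].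

Definition minimizer (R : realType) (d : nat) (f : 'rV[R]_d -> R)
    (x : 'rV[R]_d) : Prop := forall y, f x <= f y.

Definition function_class (R : realType) (L r : R) (d : nat) (x0 : 'rV[R]_d) :
    set ('rV[R]_d -> R) :=
  [set f | [/\ convex_function setT f,
               forall x g, subdifferential f x g -> enorm g <= L &
               exists2 xs, minimizer f xs & enorm (xs - x0) <= r]].

(* Nonnegative combinations of u 0, ..., u k.-1; this is [set 0] for k = 0. *)
Definition cone (R : realType) (d : nat) (u : nat -> 'rV[R]_d) (k : nat) :
    set 'rV[R]_d :=
  [set v | exists2 h : 'I_k -> R,
     forall i, 0 <= h i & v = \sum_(i < k) h i *: u i].

(* A deterministic algorithm, defined in every dimension: both maps take the
   starting point and the list of corrupted subgradients received so far. *)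
Record algorithm (R : realType) := Algorithm {
  next_iterate : forall d : nat, 'rV[R]_d -> seq 'rV[R]_d -> 'rV[R]_d;
  final_output : forall d : nat, 'rV[R]_d -> seq 'rV[R]_d -> 'rV[R]_d }.

(* x_k when gt lists the corrupted subgradients; only gt 0, ..., gt k.-1 are
   read. *)
Definition iterate (R : realType) (alg : algorithm R) (d : nat)
    (x0 : 'rV[R]_d) (gt : nat -> 'rV[R]_d) (k : nat) : 'rV[R]_d :=
  if k == 0%N then x0 else next_iterate alg x0 (mkseq gt k).

(* x_{N+1}; like x_N, it is computed from gt 0, ..., gt N.-1. *)
Definition output (R : realType) (alg : algorithm R) (N d : nat)
    (x0 : 'rV[R]_d) (gt : nat -> 'rV[R]_d) : 'rV[R]_d :=
  final_output alg x0 (mkseq gt N).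

Definition corrupted (R : realType) (d : nat) (g e : nat -> 'rV[R]_d) :
    nat -> 'rV[R]_d := fun k => g k + e k.

(* The data of an N-step run of alg on a problem instance; only the values of
   g and e at k < N matter. *)
Definition instance (R : realType) (N : nat) (L r gamma : R)
    (alg : algorithm R) (d : nat) (x0 : 'rV[R]_d) (f : 'rV[R]_d -> R)
    (g e : nat -> 'rV[R]_d) : Prop :=
  [/\ function_class L r x0 f,
      forall k, (k < N)%N ->
        subdifferential f (iterate alg x0 (corrupted g e) k) (g k) &
      \sum_(i < N) enorm (e i) ^+ 2 <= gamma ^+ 2].

Definition cone_condition (R : realType) (N : nat) (L r gamma : R)
    (alg : algorithm R) : Prop :=
  forall (d : nat) (x0 : 'rV[R]_d) (f : 'rV[R]_d -> R)
    (g e : nat -> 'rV[R]_d),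
  instance N L r gamma alg x0 f g e ->
  (forall k, (1 <= k <= N)%N ->
     [set x0 - v | v in cone (corrupted g e) k]
       (iterate alg x0 (corrupted g e) k)) /\
  [set x0 - v | v in cone (corrupted g e) N]
    (output alg N x0 (corrupted g e)).

(* Rows and columns of the Gram matrix are indexed, in this order, by
   x_0 - x_*, then g_0, ..., g_{N+1}, then e_0, ..., e_{N-1}. *)
Definition x_idx (N : nat) : 'I_(1 + (N + 2 + N)) := lshift (N + 2 + N) ord0.
Definition g_idx (N : nat) (i : 'I_(N + 2)) : 'I_(1 + (N + 2 + N)) :=
  rshift 1 (lshift N i).
Definition e_idx (N : nat) (j : 'I_N) : 'I_(1 + (N + 2 + N)) :=
  rshift 1 (rshift (N + 2) j).

Definition psd (R : realType) (n : nat) (G : 'M[R]_n) : Prop :=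
  G^T = G /\ forall v : 'rV[R]_n, 0 <= (v *m G *m v^T) 0 0.

(* lshift 2 j is j : 'I_N seen in 'I_(N + 2), so that g_idx (lshift 2 j) is the
   symbol g_j. *)
Definition feasible (R : realType) (N : nat) (L r gamma : R)
    (G : 'M[R]_(1 + (N + 2 + N))) (Delta : R) : Prop :=
  (psd G /\ 0 <= Delta) /\
  [/\ forall (i : 'I_(N + 2)) (j : 'I_N), (j < i)%N ->
        G (g_idx (lshift 2 j)) (g_idx i) + G (e_idx j) (g_idx i) = 0,
      forall (i : 'I_(N + 2)) (j : 'I_N), (i <= j)%N ->
        0 <= G (g_idx (lshift 2 j)) (g_idx i) + G (e_idx j) (g_idx i),
      forall i : 'I_(N + 2), G (x_idx N) (g_idx i) = Delta,
      G (x_idx N) (x_idx N) <= r ^+ 2 &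
      (forall i : 'I_(N + 2), G (g_idx i) (g_idx i) <= L ^+ 2) /\
      \sum_(i < N) G (e_idx i) (e_idx i) <= gamma ^+ 2].

(* The supremum is taken in \bar R, so no convention for unbounded or empty
   sets of objective values is involved. *)
Definition optimal_value (R : realType) (N : nat) (L r gamma : R) : \bar R :=
  ereal_sup [set Delta%:E | Delta in
    [set Delta | exists G, feasible (N := N) L r gamma G Delta]].

(* Main.v *)
Require Import Defs.
From mathcomp Require Import boolp topology normedtype derive ring lra.
Import Order.TTheory GRing.Theory Num.Theory numFieldNormedType.Exports.
Local Open Scope ring_scope.

Set Implicit Arguments.
Unset Strict Implicit.
Unset Printing Implicit Defensive.

(** Why the theorem is true.

    Let (G, Delta) be an optimal point of the program, and factor G as a Gram
    matrix, so that its formal symbols x = x_0 - x_*, g_i and e_j become vectors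
    of a Euclidean space.  Start at x_0 = 0 and take
      f y = max (- Delta, max_i <g_i, y>).
    It is convex, its subgradients are no longer than the longest g_i, and it
    attains its least value - Delta at - x because <g_i, x> = Delta for all i
    ([resisting_class], [resisting_min]).

    The sign constraints of the program make f useless to the algorithm.  If
    y = - sum_(j < k) h_j (g_j + e_j) with h >= 0, then <g_i, y> <= 0 for every
    i, with equality as soon as i >= k.  So f y = 0 at every point available at
    step k, and g_k is active there ([resisting_cone]): answering g_k + e_k at
    step k is legitimate, whatever iterate the cone condition allowed.  The
    output is such a point for k = N, hence f (output) - f_* = 0 + Delta
    ([resisting_gap]).

    Two points need more care.
    - The cone condition only speaks of complete N-step runs, while it is needed
      at step k in order to know that step k of the run is legitimate at all.
      A run that is legitimate before step k is therefore completed by arbitrary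
      subgradients of f with no error ([extend_run]); the completed run has the
      same k-th iterate and the same k-th cone, and this closes the induction
      ([iterate_in_cone], [resisting_run]).
    - The gap must reach the supremum of the program, not just come close to it.
      The entries of a positive semidefinite matrix are bounded by its diagonal,
      so the feasible matrices form a compact set and the optimum is attained
      ([optimal_value_attained]). *)

(** * The Euclidean inner product *)

Section InnerProduct.
Variables (R : realType) (d : nat).
Implicit Types u v w : 'rV[R]_d.

Lemma dotE u v : dot u v = \sum_i u 0 i * v 0 i.
Proof. by rewrite /dot mxE; apply: eq_bigr => i _; rewrite mxE. Qed.

Lemma dotC u v : dot u v = dot v u.
Proof. by rewrite !dotE; apply: eq_bigr => i _; rewrite mulrC. Qed.

Lemma dotDr u v w : dot u (v + w) = dot u v + dot u w.
Proof. by rewrite /dot linearD mulmxDr mxE. Qed.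

Lemma dotZr a u v : dot u (a *: v) = a * dot u v.
Proof. by rewrite /dot linearZ /= -scalemxAr mxE. Qed.

Lemma dotNr u v : dot u (- v) = - dot u v.
Proof. by rewrite -scaleN1r dotZr mulN1r. Qed.

Lemma dotBr u v w : dot u (v - w) = dot u v - dot u w.
Proof. by rewrite dotDr dotNr. Qed.

Lemma dot0r u : dot u 0 = 0.
Proof. by rewrite /dot linear0 mulmx0 mxE. Qed.

Lemma dot_sumr u n (F : 'I_n -> 'rV[R]_d) :
  dot u (\sum_i F i) = \sum_i dot u (F i).
Proof. exact: (big_morph (dot u) (dotDr u) (dot0r u)). Qed.

Lemma dot_ge0 u : 0 <= dot u u.
Proof. by rewrite dotE sumr_ge0 // => i _; rewrite -expr2 sqr_ge0. Qed.

Lemma sqr_enorm u : enorm u ^+ 2 = dot u u.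
Proof. by rewrite sqr_sqrtr ?dot_ge0. Qed.

Lemma enorm_le c u : 0 <= c -> (enorm u <= c) = (dot u u <= c ^+ 2).
Proof.
by move=> c0; rewrite -sqr_enorm ler_pXn2r // nnegrE sqrtr_ge0.
Qed.

End InnerProduct.

(** * Gram factorization of positive semidefinite matrices *)

Section Gram.
Variable R : realType.

(** Cholesky factorization, by induction on the size: after splitting off the
    first row and column, the Schur complement of the corner a is again positive
    semidefinite, hence a Gram matrix.  A null corner needs no separate
    construction: the first column then vanishes, and the convention 0^-1 = 0
    makes the same formulas meaningful. *)
Lemma psd_gram n (G : 'M[R]_n) : psd G -> exists B : 'M[R]_n, G = B *m B^T.
Proof.
elim: n G => [|n IH] G [Gsym Gpos].
  by exists 0; apply/matrixP => -[].
move: G Gsym Gpos; rewrite -[n.+1]/(1 + n)%N => G Gsym Gpos.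
pose u := dlsubmx G; pose H := drsubmx G; pose a : R := G 0 0.
have ulE : ulsubmx G = a%:M.
  by apply/matrixP => i j; rewrite !ord1 !mxE /= mulr1n; congr (G _ _); apply: val_inj.
have urE : ursubmx G = u^T by rewrite /u trmx_dlsub Gsym.
have GE : G = block_mx a%:M u^T u H by rewrite -ulE -urE submxK.
have Hsym : H^T = H by rewrite /H trmx_drsub Gsym.
have qE (t : R) (w : 'rV[R]_n) :
    (row_mx t%:M w *m G *m (row_mx t%:M w)^T) 0 0
      = t ^+ 2 * a + t * ((w *m u) 0 0) *+ 2 + (w *m H *m w^T) 0 0.
  rewrite GE mul_row_block tr_row_mx mul_row_col tr_scalar_mx !mul_mx_scalar.
  rewrite mulmxDl mul_scalar_mx -scalemxAl -trmx_mul.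
  move: (w *m u) (w *m H *m w^T) => p q.
  by rewrite !mxE /= !mulr1n; ring.
have Gpos' (t : R) (w : 'rV[R]_n) :
  0 <= t ^+ 2 * a + t * ((w *m u) 0 0) *+ 2 + (w *m H *m w^T) 0 0.
  by rewrite -qE.
have a_ge0 : 0 <= a.
  by have := Gpos' 1 0; rewrite !mul0mx !mxE expr1n mul1r mulr0 mul0rn !addr0.
have u_eq0 : a = 0 -> u = 0.
  (* With a = 0 the quadratic form is affine in t; a nonzero slope would make it
     negative at the chosen t, where it equals -1. *)
  move=> a0; apply/matrixP => i j; rewrite (ord1 j) [RHS]mxE.
  have [//|p_neq0] := eqVneq (u i 0) 0.
  pose w : 'rV[R]_n := delta_mx 0 i.
  have wu : (w *m u) 0 0 = u i 0 by rewrite -rowE mxE.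
  have := Gpos' (- ((w *m H *m w^T) 0 0 + 1) / (u i 0 *+ 2)) w.
  rewrite wu a0; set c := (w *m H *m w^T) 0 0.
  rewrite (_ : _ + _ = -1) ?ler0N1 //; field.
  by rewrite p_neq0.
pose S := H - a^-1 *: (u *m u^T).
have /IH[C SE] : psd S.
  split=> [|w].
    by rewrite /S linearB linearZ /= Hsym trmx_mul trmxK.
  (* This t minimizes the quadratic form in the first coordinate, which leaves
     the Schur complement. *)
  have := Gpos' (- a^-1 * (w *m u) 0 0) w.
  rewrite /S mulmxBr mulmxBl -scalemxAr -scalemxAl !mulmxA -(mulmxA (w *m u)).
  rewrite -trmx_mul.
  move: (w *m u) (w *m H *m w^T) => p q; rewrite !mxE big_ord1 !mxE.
  have [->|a_neq0] := eqVneq a 0; first by rewrite invr0; lra.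
  by rewrite (_ : _ + _ = q 0 0 - a^-1 * (p 0 0 * p 0 0)) //; field.
exists (block_mx (Num.sqrt a)%:M 0 ((Num.sqrt a)^-1 *: u) C).
rewrite GE tr_block_mx mulmx_block !tr_scalar_mx !trmx0 !mulmx0 !mul0mx !addr0.
rewrite linearZ /= mul_scalar_mx mul_mx_scalar -scalemxAl -scalemxAr -SE /S.
rewrite mul_scalar_mx -scalemxAr !scalerA addrCA -scalerBl scale_scalar_mx -expr2.
have [a0|a_neq0] := eqVneq a 0.
  by rewrite u_eq0 // a0 sqrtr0 expr0n mul0mx trmx0 !scaler0 addr0.
have s_neq0 : Num.sqrt a != 0 by rewrite sqrtr_eq0 -ltNge lt_neqAle eq_sym a_neq0.
rewrite -expr2 exprVn sqr_sqrtr // subrr scale0r addr0.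
by rewrite divff // mulVf // !scale1r.
Qed.

Lemma gram_entry m n (B : 'M[R]_(m, n)) i j :
  (B *m B^T) i j = dot (row i B) (row j B).
Proof. by rewrite dotE mxE; apply: eq_bigr => k _; rewrite !mxE. Qed.

Lemma psd_diag_ge0 n (G : 'M[R]_n) i : psd G -> 0 <= G i i.
Proof. by move=> /psd_gram[B ->]; rewrite gram_entry dot_ge0. Qed.

(** For Gram vectors b_i, expand |b_i + b_j|^2 >= 0 and |b_i - b_j|^2 >= 0. *)
Lemma psd_entry_le n (G : 'M[R]_n) (M : R) :
  psd G -> (forall i, G i i <= M) -> forall i j, - M <= G i j <= M.
Proof.
move=> /psd_gram[B ->] diag i j.
have := diag i; have := diag j; rewrite !gram_entry.
have := dot_ge0 (row i B + row j B); have := dot_ge0 (row i B - row j B).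
rewrite !dotBr !dotDr ![dot (_ - _) _]dotC ![dot (_ + _) _]dotC !dotBr !dotDr.
by rewrite (dotC (row j B) (row i B)) => ? ? ? ?; apply/andP; split; lra.
Qed.

End Gram.

(** * Maxima of linear functions and a constant *)

Section MaxLinear.
Variables (R : realType) (d n : nat) (c : R) (g : nat -> 'rV[R]_d).

Definition maxlin (y : 'rV[R]_d) : R := \big[Num.max/c]_(i < n) dot (g i) y.

Lemma maxlin_ge_floor y : c <= maxlin y.
Proof. exact: bigmax_ge_id. Qed.

Lemma maxlin_ge y i : (i < n)%N -> dot (g i) y <= maxlin y.
Proof. by move=> ltin; exact: (le_bigmax c _ (Ordinal ltin)). Qed.

Lemma maxlin_le y m :
  c <= m -> (forall i, (i < n)%N -> dot (g i) y <= m) -> maxlin y <= m.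
Proof. by move=> cm gm; apply: bigmax_le => // i _; exact: gm. Qed.

Lemma maxlin_attained y :
  maxlin y = c \/ exists2 i, (i < n)%N & maxlin y = dot (g i) y.
Proof.
rewrite /maxlin; elim/big_ind: _ => [|a b Pa Pb|i _]; first by left.
  by case: leP.
by right; exists i.
Qed.

Lemma maxlin_convex : convex_function setT maxlin.
Proof.
move=> t x y _ _; rewrite convRE /unstable.onem.
have t0 : 0 <= t%:num by [].
have t1 : 0 <= 1 - t%:num by rewrite subr_ge0.
apply: maxlin_le => [|i ltin].
  have := ler_wpM2l t0 (maxlin_ge_floor x).
  have := ler_wpM2l t1 (maxlin_ge_floor y).
  lra.
rewrite [dot _ _]dotDr !dotZr.
by apply: lerD; apply: ler_wpM2l => //; exact: maxlin_ge.
Qed.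

Lemma maxlin_active_subgradient y i :
  (i < n)%N -> maxlin y = dot (g i) y -> subdifferential maxlin y (g i).
Proof. by move=> ltin yi z; rewrite yi -dotDr addrC subrK maxlin_ge. Qed.

(** Where the constant c is the maximum, 0 is a subgradient; elsewhere an active
    linear piece provides one. *)
Lemma maxlin_subdifferentiable y : exists s, subdifferential maxlin y s.
Proof.
case: (maxlin_attained y) => [yc|[i ltin yi]]; last first.
  by exists (g i); exact: maxlin_active_subgradient.
by exists 0 => z; rewrite dotC dot0r addr0 yc maxlin_ge_floor.
Qed.

(** The subgradient inequality at y + s gives |s|^2 <= <g_i, s> for a piece i that
    is active there (or s = 0), and then |g_i - s|^2 >= 0 gives |s| <= |g_i|. *)
Lemma maxlin_subgradient_le L y s :
    0 <= L -> (forall i, (i < n)%N -> dot (g i) (g i) <= L ^+ 2) ->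
  subdifferential maxlin y s -> enorm s <= L.
Proof.
move=> L0 gL /(_ (y + s)); rewrite addrAC subrr add0r enorm_le //.
case: (maxlin_attained (y + s)) => [->|[i ltin ->]] sub.
  have := maxlin_ge_floor y; have := sqr_ge0 L; lra.
have := dot_ge0 (g i - s); have := maxlin_ge y ltin; have := gL i ltin.
move: sub; rewrite dotDr !dotBr ![dot (_ - _) _]dotC !dotBr (dotC s (g i)); lra.
Qed.

End MaxLinear.

(** * Runs that agree on their first steps *)

Section PartialRun.
Variables (R : realType) (alg : algorithm R) (d : nat) (x0 : 'rV[R]_d).

Lemma eq_corrupted k (g g' e e' : nat -> 'rV[R]_d) :
    (forall j, (j < k)%N -> g j = g' j) -> (forall j, (j < k)%N -> e j = e' j) ->
  forall j, (j < k)%N -> corrupted g e j = corrupted g' e' j.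
Proof. by move=> gg ee j jk; rewrite /corrupted gg // ee. Qed.

Lemma eq_mkseq_lt (T : Type) (u u' : nat -> T) k :
  (forall j, (j < k)%N -> u j = u' j) -> mkseq u k = mkseq u' k.
Proof.
move=> uu; apply/eq_in_map => j; rewrite mem_iota add0n; exact: uu.
Qed.

Lemma eq_iterate (u u' : nat -> 'rV[R]_d) k :
  (forall j, (j < k)%N -> u j = u' j) -> iterate alg x0 u k = iterate alg x0 u' k.
Proof. by move=> uu; rewrite /iterate (eq_mkseq_lt uu). Qed.

Lemma eq_cone (u u' : nat -> 'rV[R]_d) k :
  (forall j, (j < k)%N -> u j = u' j) -> cone u k = cone u' k.
Proof.
move=> uu; have eq_comb (h : 'I_k -> R) :
    \sum_(i < k) h i *: u i = \sum_(i < k) h i *: u' i.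
  by apply: eq_bigr => i _; rewrite uu.
by apply/seteqP; split=> v [h h0 ->]; exists h => //; rewrite eq_comb.
Qed.

(** A run that is legitimate before step k has a legitimate continuation to any
    length N, with no further error.  The subgradients are chosen one step at a
    time, since each iterate depends on the answers given before it; the error
    sequence is fixed beforehand. *)
Lemma extend_run (f : 'rV[R]_d -> R) (g e : nat -> 'rV[R]_d) k N :
    (forall y, exists s, subdifferential f y s) ->
    (forall j, (j < k)%N ->
       subdifferential f (iterate alg x0 (corrupted g e) j) (g j)) ->
  exists g' e' : nat -> 'rV[R]_d,
    [/\ forall j, (j < k)%N -> g' j = g j,
        forall j, e' j = if (j < k)%N then e j else 0 &
        forall j, (j < N)%N ->
          subdifferential f (iterate alg x0 (corrupted g' e') j) (g' j)].
Proof.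
move=> fsub valid.
pose e' j := if (j < k)%N then e j else 0.
have e'E j : (j < k)%N -> e' j = e j by move=> jk; rewrite /e' jk.
suff [g' [gg' valid']] : exists g' : nat -> 'rV[R]_d,
    (forall j, (j < k)%N -> g' j = g j) /\
    forall j, (j < N)%N ->
      subdifferential f (iterate alg x0 (corrupted g' e') j) (g' j).
  by exists g', e'; split.
elim: N => [|N [g' [gg' valid']]]; first by exists g.
have [ltNk|lekN] := ltnP N k.
  exists g'; split=> // j; rewrite ltnS leq_eqVlt => /predU1P[->|]; last exact: valid'.
  rewrite gg' //; have -> : iterate alg x0 (corrupted g' e') N
      = iterate alg x0 (corrupted g e) N; last exact: valid.
  apply/eq_iterate/eq_corrupted => j' lt_j'N.
    by rewrite gg' // (ltn_trans lt_j'N).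
  by rewrite e'E // (ltn_trans lt_j'N).
have [s sP] := fsub (iterate alg x0 (corrupted g' e') N).
pose g'' j := if j == N then s else g' j.
have g''E j : (j < N)%N -> g'' j = g' j by rewrite /g'' => /ltn_eqF ->.
have itE j : (j <= N)%N -> iterate alg x0 (corrupted g'' e') j
    = iterate alg x0 (corrupted g' e') j.
  move=> lejN; apply/eq_iterate/eq_corrupted => // j' lt_j'j.
  by rewrite g''E // (leq_trans lt_j'j).
exists g''; split=> [j ltjk|j].
  by rewrite g''E ?gg' // (leq_trans ltjk).
rewrite ltnS leq_eqVlt => /predU1P[->|ltjN].
  by rewrite itE // /g'' eqxx.
by rewrite itE ?g''E ?(ltnW ltjN) //; exact: valid'.
Qed.

End PartialRun.

(** * The resisting instance *)

(** Here x, g_i and e_j are Gram vectors of a feasible matrix with objective value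
    Delta; the starting point is 0, so that the minimizer x_* is - x. *)
Section Resisting.
Variables (R : realType) (N d : nat) (L r gamma Delta : R).
Variables (g e : nat -> 'rV[R]_d) (x : 'rV[R]_d).
Hypothesis L_ge0 : 0 <= L.
Hypothesis r_ge0 : 0 <= r.
Hypothesis Delta_ge0 : 0 <= Delta.
Hypothesis g_orth : forall i j, (i < N + 2)%N -> (j < N)%N -> (j < i)%N ->
  dot (g i) (corrupted g e j) = 0.
Hypothesis g_acute : forall i j, (i < N + 2)%N -> (j < N)%N -> (i <= j)%N ->
  0 <= dot (g i) (corrupted g e j).
Hypothesis g_x : forall i, (i < N + 2)%N -> dot (g i) x = Delta.
Hypothesis x_le : dot x x <= r ^+ 2.
Hypothesis g_le : forall i, (i < N + 2)%N -> dot (g i) (g i) <= L ^+ 2.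
Hypothesis e_le : \sum_(i < N) dot (e i) (e i) <= gamma ^+ 2.

Let f := maxlin (N + 2) (- Delta) g.

(** Every linear piece takes the value - Delta at - x, so the floor - Delta is
    reached there. *)
Lemma resisting_minimizer : minimizer f (- x).
Proof.
move=> y; apply: le_trans (maxlin_ge_floor _ _ _ y).
by apply: maxlin_le => // i ltin; rewrite dotNr g_x.
Qed.

Lemma resisting_min : f (- x) = - Delta.
Proof.
apply/eqP; rewrite eq_le maxlin_ge_floor andbT.
by apply: maxlin_le => // i ltin; rewrite dotNr g_x.
Qed.

Lemma resisting_class : function_class L r 0 f.
Proof.
split; first exact: maxlin_convex.
  by move=> y s; apply: maxlin_subgradient_le.
exists (- x); first exact: resisting_minimizer.
by rewrite subr0 enorm_le // dotNr dotC dotNr opprK.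
Qed.

(** All of g_k, ..., g_{N+1} vanish on the k-th cone, and the other g_i are
    nonpositive on its opposite: for y in x_0 - cone, no linear piece exceeds
    the value 0 of the k-th one.  The case k = N covers the output, because
    there are more than N pieces. *)
Lemma resisting_cone k y : (k <= N)%N ->
    [set 0 - v | v in cone (corrupted g e) k]%classic y ->
  f y = 0 /\ dot (g k) y = 0.
Proof.
move=> lekN [_ [h h_ge0 ->] <-].
have dot_comb i : dot (g i) (0 - \sum_(j < k) h j *: corrupted g e j)
    = - \sum_(j < k) h j * dot (g i) (corrupted g e j).
  by rewrite sub0r dotNr dot_sumr; under eq_bigr do rewrite dotZr.
have ltkn : (k < N + 2)%N by rewrite addn2 ltnS (leq_trans lekN).
have ltjN (j : 'I_k) : (j < N)%N by exact: leq_trans lekN.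
have dot_k : dot (g k) (0 - \sum_(j < k) h j *: corrupted g e j) = 0.
  by rewrite dot_comb big1 ?oppr0 // => j _; rewrite g_orth ?mulr0.
split=> //; apply/eqP; rewrite eq_le -{2}dot_k maxlin_ge // andbT.
apply: maxlin_le => [|i ltin]; first by rewrite oppr_le0.
rewrite dot_comb oppr_le0; apply: sumr_ge0 => j _; apply: mulr_ge0 => //.
by have [ltji|leij] := ltnP j i; [rewrite g_orth|exact: g_acute].
Qed.

Variable alg : algorithm R.
Hypothesis alg_cone : cone_condition N L r gamma alg.

(** The hypothesis on [alg] only applies to full runs, so it is used on a
    completion of the first k steps, which has the same k-th iterate and cone. *)
Lemma iterate_in_cone k : (k <= N)%N ->
    (forall j, (j < k)%N ->
       subdifferential f (iterate alg 0 (corrupted g e) j) (g j)) ->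
  [set 0 - v | v in cone (corrupted g e) k]%classic
    (iterate alg 0 (corrupted g e) k).
Proof.
case: k => [_ _|k ltkN valid].
  by exists 0; rewrite ?subr0 //; exists (fun=> 0) => //; rewrite big_ord0.
have [g' [e' [gg' e'E valid']]] :=
  extend_run N (@maxlin_subdifferentiable _ _ (N + 2) (- Delta) g) valid.
have run : instance N L r gamma alg 0 f g' e'.
  split=> //; first exact: resisting_class.
  apply: le_trans e_le; apply: ler_sum => i _; rewrite sqr_enorm e'E.
  by case: ifP => // _; rewrite dot0r dot_ge0.
have [/(_ k.+1 ltkN) + _] := alg_cone run.
have gtE : forall j, (j < k.+1)%N -> corrupted g' e' j = corrupted g e j.
  by apply: eq_corrupted => // j ltjk; rewrite e'E ltjk.
by rewrite (eq_iterate _ _ gtE) (eq_cone gtE).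
Qed.

Lemma resisting_run k : (k <= N)%N -> forall j, (j < k)%N ->
  subdifferential f (iterate alg 0 (corrupted g e) j) (g j).
Proof.
elim: k => [//|k IH] ltkN j.
rewrite ltnS leq_eqVlt => /predU1P[->|]; last exact/IH/ltnW.
have [fk gk] := resisting_cone (ltnW ltkN) (iterate_in_cone (ltnW ltkN) (IH (ltnW ltkN))).
apply: maxlin_active_subgradient; last by rewrite -/f fk gk.
by rewrite ltn_addr.
Qed.

Lemma resisting_instance : instance N L r gamma alg 0 f g e.
Proof.
split; [exact: resisting_class|exact: resisting_run|].
by apply: le_trans e_le; apply: ler_sum => i _; rewrite sqr_enorm.
Qed.

Lemma resisting_gap : f (output alg N 0 (corrupted g e)) - f (- x) = Delta.
Proof.
have [_ /(resisting_cone (leqnn N))[-> _]] := alg_cone resisting_instance.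
by rewrite resisting_min sub0r opprK.
Qed.

End Resisting.

(** * The optimal value of the program is attained *)

Section Attainment.
Local Open Scope classical_set_scope.

Lemma closed_forall (T : topologicalType) (I : Type) (P : I -> T -> Prop) :
  (forall i, closed [set x | P i x]) -> closed [set x | forall i, P i x].
Proof.
move=> clP; rewrite (_ : [set x | _] = \bigcap_(i in setT) [set x | P i x]).
  by apply: closed_bigI.
by apply/seteqP; split=> y /= Py i => [_|]; apply: Py.
Qed.

Lemma closed_le_fun (R : realType) (T : topologicalType) (u v : T -> R) :
  continuous u -> continuous v -> closed [set x | u x <= v x].
Proof.
move=> cu cv; rewrite (_ : [set x | _] = (v \- u) @^-1` [set t | 0 <= t]).
  apply: preimage_closed (@closed_ge R 0) => x _.
  by apply: continuousB; [exact: cv|exact: cu].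
by apply/seteqP; split=> x /=; rewrite subr_ge0.
Qed.

Lemma closed_eq_fun (R : realType) (T : topologicalType) (u v : T -> R) :
  continuous u -> continuous v -> closed [set x | u x = v x].
Proof.
move=> cu cv; rewrite (_ : [set x | _] = [set x | u x <= v x] `&` [set x | v x <= u x]).
  by apply: closedI; exact: closed_le_fun.
apply/seteqP; split=> x /= => [->//|[uv vu]].
by apply/eqP; rewrite eq_le uv vu.
Qed.

Lemma continuous_sum_fun (R : realType) (T : topologicalType) (I : finType)
    (u : I -> T -> R) :
  (forall i, continuous (u i)) -> continuous (fun x => \sum_i u i x).
Proof.
move=> cu x; apply: cvg_big => [|i _]; last exact: cu.
exact: add_continuous.
Qed.

Lemma entry_continuous (R : realType) m (i j : 'I_m) :
  continuous (fun v : 'rV[R]_(m * m) => (vec_mx v : 'M_m) i j).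
Proof.
rewrite (_ : (fun v => _) = fun v : 'rV[R]_(m * m) => v 0 (mxvec_index i j)).
  exact: coord_continuous.
by apply/funext => v; rewrite mxE.
Qed.

Lemma closed_psd (R : realType) m :
  closed [set v : 'rV[R]_(m * m) | psd (vec_mx v : 'M_m)].
Proof.
rewrite (_ : [set v | _] =
    [set v : 'rV[R]_(m * m) | forall i j, (vec_mx v : 'M_m) j i = vec_mx v i j]
    `&` [set v | forall w : 'rV_m, 0 <= (w *m vec_mx v *m w^T) 0 0]); last first.
  apply/seteqP; split=> v [/= vT vpos]; split=> //.
    by move=> i j; rewrite -[in RHS]vT [RHS]mxE.
  by apply/matrixP => i j; rewrite [LHS]mxE vT.
apply: closedI.
  by do 2!(apply: closed_forall => ?); apply: closed_eq_fun; exact: entry_continuous.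
apply: closed_forall => w; apply: closed_le_fun; first exact: cst_continuous.
rewrite (_ : (fun v => _) = fun v : 'rV[R]_(m * m) =>
    \sum_j (\sum_i w 0 i * vec_mx v i j) * w 0 j).
  apply: continuous_sum_fun => j v; apply: continuousM; last exact: cst_continuous.
  apply: continuous_sum_fun => {v} i v; apply: continuousM; first exact: cst_continuous.
  exact: entry_continuous.
apply/funext => v; rewrite mxE; apply: eq_bigr => j _.
by rewrite !mxE.
Qed.

Variables (R : realType) (N : nat) (L r gamma : R).
Let n := (1 + (N + 2 + N))%N.

(** On feasible matrices, Delta is the entry in row x_0 - x_* and column g_i for
    each i; the choice i = N is arbitrary.  Eliminating Delta in this way makes
    the program an optimization over matrices alone. *)
Let objective (G : 'M[R]_n) : R := G (x_idx N) (g_idx (rshift N (0 : 'I_2))).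

(** Matrices are flattened to row vectors so that [rV_compact] applies. *)
Let feasible_vec := [set v : 'rV[R]_(n * n) |
  feasible (N := N) L r gamma (vec_mx v) (objective (vec_mx v))].

Lemma closed_feasible : closed feasible_vec.
Proof.
rewrite (_ : feasible_vec =
    [set v : 'rV[R]_(n * n) | psd (vec_mx v : 'M_n)] `&`
    [set v | 0 <= objective (vec_mx v)] `&`
    [set v | forall (i : 'I_(N + 2)) (j : 'I_N), (j < i)%N ->
      (vec_mx v : 'M_n) (g_idx (lshift 2 j)) (g_idx i)
        + (vec_mx v : 'M_n) (e_idx j) (g_idx i) = 0] `&`
    [set v | forall (i : 'I_(N + 2)) (j : 'I_N), (i <= j)%N ->
      0 <= (vec_mx v : 'M_n) (g_idx (lshift 2 j)) (g_idx i)
        + (vec_mx v : 'M_n) (e_idx j) (g_idx i)] `&`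
    [set v | forall i : 'I_(N + 2),
      (vec_mx v : 'M_n) (x_idx N) (g_idx i) = objective (vec_mx v)] `&`
    [set v | (vec_mx v : 'M_n) (x_idx N) (x_idx N) <= r ^+ 2] `&`
    [set v | forall i : 'I_(N + 2), (vec_mx v : 'M_n) (g_idx i) (g_idx i) <= L ^+ 2] `&`
    [set v | \sum_(i < N) (vec_mx v : 'M_n) (e_idx i) (e_idx i) <= gamma ^+ 2]).
  have cont_entry := @entry_continuous R n.
  have cst (a : R) : continuous (fun _ : 'rV[R]_(n * n) => a) by exact: cst_continuous.
  have cont_add i j i' j' : continuous (fun v : 'rV[R]_(n * n) =>
      (vec_mx v : 'M_n) i j + (vec_mx v : 'M_n) i' j').
    by move=> v; apply: continuousD; exact: entry_continuous.
  have cont_obj : continuous (fun v : 'rV[R]_(n * n) => objective (vec_mx v)).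
    exact: entry_continuous.
  apply: closedI; last by apply: closed_le_fun => //; exact: continuous_sum_fun.
  apply: closedI; last by apply: closed_forall => ?; exact: closed_le_fun.
  apply: closedI; last exact: closed_le_fun.
  apply: closedI; last by apply: closed_forall => ?; exact: closed_eq_fun.
  apply: closedI; last by do 3!(apply: closed_forall => ?); exact: closed_le_fun.
  apply: closedI; last by do 3!(apply: closed_forall => ?); exact: closed_eq_fun.
  apply: closedI; first exact: closed_psd.
  exact: closed_le_fun.
apply/seteqP; split=> v /=; first by case=> -[? ?] [? ? ? ? [? ?]].
by case=> -[[[[[[? ?] ?] ?] ?] ?] ?] ?.
Qed.

(** The program bounds every diagonal entry by r^2, L^2 or gamma^2; the sum of the
    three is a common bound. *)
Lemma feasible_entry_le G Delta : feasible (N := N) L r gamma G Delta ->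
  let M := r ^+ 2 + L ^+ 2 + gamma ^+ 2 in forall i j, - M <= G i j <= M.
Proof.
move=> [[psdG _] [_ _ _ xr [gL eg]]] M; apply: psd_entry_le => // i.
have := sqr_ge0 r; have := sqr_ge0 L; have := sqr_ge0 gamma; rewrite /M.
case: (split_ordP i) => [k ->|k ->].
  by rewrite (ord1 k) -/(x_idx N); lra.
case: (split_ordP k) => [l ->|l ->].
  by have := gL l; rewrite /g_idx; lra.
have: G (e_idx l) (e_idx l) <= gamma ^+ 2.
  apply: le_trans eg; rewrite (bigD1 l) //= lerDl sumr_ge0 // => j _.
  exact: psd_diag_ge0.
by rewrite /e_idx; lra.
Qed.

Lemma compact_feasible : compact feasible_vec.
Proof.
pose M := r ^+ 2 + L ^+ 2 + gamma ^+ 2.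
apply: subclosed_compact closed_feasible
  (rV_compact (fun k : 'I_(n * n) => @segment_compact R (- M) M)) _.
move=> v /feasible_entry_le vM k.
case/mxvec_indexP: k => i j /=; have := vM i j.
by rewrite mxE in_itv.
Qed.

Lemma optimal_value_attained : exists G Delta,
  feasible (N := N) L r gamma G Delta /\
  optimal_value N L r gamma = Delta%:E.
Proof.
have feas0 : feasible_vec 0.
  rewrite /feasible_vec /objective /= linear0; split.
    split; last by rewrite mxE.
    by split=> [|w]; rewrite ?trmx0 // mulmx0 mul0mx mxE.
  split=> [i j _|i j _|i||]; rewrite ?mxE ?addr0 ?sqr_ge0 //.
  split=> [i|]; first by rewrite mxE sqr_ge0.
  by rewrite big1 ?sqr_ge0 // => i _; rewrite mxE.
have [||v /set_mem feasv vmax] :=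
  compact_EVT_max (f := fun v => objective (vec_mx v)) _ compact_feasible _.
- by exists 0.
- exact/continuous_subspaceT/entry_continuous.
exists (vec_mx v), (objective (vec_mx v)); split=> //.
apply/eqP; rewrite eq_le; apply/andP; split.
  apply: ge_ereal_sup => _ [Delta [G feasG] <-].
  have DE : Delta = objective G by case: feasG => _ [_ _ + _ _]; rewrite /objective => ->.
  have := vmax (mxvec G); rewrite mxvecK lee_fin DE; apply.
  by apply/mem_set; rewrite /feasible_vec /= mxvecK -DE.
by apply: ereal_sup_ubound; exists (objective (vec_mx v)) => //; exists (vec_mx v).
Qed.

End Attainment.

Theorem theorem1 (R : realType) (N : nat) (L r gamma : R)
    (hN : (1 <= N)%N) (hL : 0 < L) (hr : 0 < r) (hgamma : 0 <= gamma)
    (alg : algorithm R) (halg : cone_condition N L r gamma alg) :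
  exists (d : nat) (x0 xs : 'rV[R]_d) (f : 'rV[R]_d -> R)
         (g e : nat -> 'rV[R]_d),
    [/\ instance N L r gamma alg x0 f g e,
        minimizer f xs &
        (optimal_value N L r gamma <=
           (f (output alg N x0 (corrupted g e)) - f xs)%:E)%E].
Proof.
have [G [Delta [feas ->]]] := optimal_value_attained N L r gamma.
case: feas => -[psdG Delta_ge0] [orth acute xg xr [gL eg]].
have [B GE] := psd_gram psdG.
have dotB i j : dot (row i B) (row j B) = G i j.
  by rewrite GE gram_entry.
have Gsym i j : G i j = G j i by rewrite -!dotB dotC.
pose g k := if insub k is Some i then row (g_idx (N := N) i) B else 0.
pose e k := if insub k is Some j then row (e_idx (N := N) j) B else 0.
have gE (i : 'I_(N + 2)) : g i = row (g_idx i) B by rewrite /g valK.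
have gE' (j : 'I_N) : g j = row (g_idx (lshift 2 j)) B by rewrite -gE.
have eE (j : 'I_N) : e j = row (e_idx j) B by rewrite /e valK.
have corrE (i : 'I_(N + 2)) (j : 'I_N) : dot (g i) (corrupted g e j)
    = G (g_idx (lshift 2 j)) (g_idx i) + G (e_idx j) (g_idx i).
  by rewrite dotDr gE gE' eE !dotB Gsym (Gsym (e_idx j)).
have g_orth i j : (i < N + 2)%N -> (j < N)%N -> (j < i)%N ->
    dot (g i) (corrupted g e j) = 0.
  move=> lti ltj; rewrite (corrE (Ordinal lti) (Ordinal ltj)).
  exact: (orth (Ordinal lti) (Ordinal ltj)).
have g_acute i j : (i < N + 2)%N -> (j < N)%N -> (i <= j)%N ->
    0 <= dot (g i) (corrupted g e j).
  move=> lti ltj; rewrite (corrE (Ordinal lti) (Ordinal ltj)).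
  exact: (acute (Ordinal lti) (Ordinal ltj)).
pose x := row (x_idx N) B.
have g_x i : (i < N + 2)%N -> dot (g i) x = Delta.
  by move=> lti; rewrite (gE (Ordinal lti)) dotB Gsym.
have x_le : dot x x <= r ^+ 2 by rewrite dotB.
have g_le i : (i < N + 2)%N -> dot (g i) (g i) <= L ^+ 2.
  by move=> lti; rewrite (gE (Ordinal lti)) dotB.
have e_le : \sum_(i < N) dot (e i) (e i) <= gamma ^+ 2.
  by under eq_bigr do rewrite eE dotB.
exists (1 + (N + 2 + N))%N, 0, (- x), (maxlin (N + 2) (- Delta) g), g, e; split.
- exact: (resisting_instance (x := x) (ltW hL) (ltW hr)).
- exact: resisting_minimizer.
- by rewrite lee_fin (resisting_gap (ltW hL) (ltW hr) Delta_ge0 g_orth g_acute g_x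
      x_le g_le e_le halg).
Qed.
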